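(* Let $\phi\neq0$, $\phi\in H_0^1(\Omega)$, solve the weighted normalized profile problem \[ -\Delta\phi=k(x)|\phi|^{q-2}\phi\ \text{ in }\Omega,\qquad \phi=0\ \text{ on }\partial\Omega . \] Let \[ K_\phi=\int_\Omega|\nabla\phi|^2\,dx=\int_\Omega k(x)|\phi|^q\,dx,\qquad \lambda_\phi(s)=\frac{s^{q-2}-a}{s^2K_\phi}\quad(s>0). \] Then \[ \Gamma_\phi=\{(\lambda_\phi(s),s\phi):s>0\} \] is an exact solution branch of the Kirchhoff problem \[ -\Bigl(a+\lambda\int_\Omega|\nabla u|^2\,dx\Bigr)\Delta u=k(x)|u|^{q-2}u\ \text{ in }\Omega,\qquad u=0\ \text{ on }\partial\Omega, \] that is, $u=s\phi$ solves it with $\lambda=\lambda_\phi(s)$ for every $s>0$. It has a unique nondegenerate turning bifurcation point \[ (\lambda_\phi^*,s_*\phi),\qquad s_*=\Bigl(\frac{2a}{4-q}\Bigr)^{\frac1{q-2}},\qquad \lambda_\phi^*=\frac{q-2}{2K_\phi}\,s_*^{q-4}. \] The branch contains exactly one solution for each $\lambda\le0$, exactly two solutions for each $0<\lambda<\lambda_\phi^*$, one turning solution for $\lambda=\lambda_\phi^*$, and no solution for $\lambda>\lambda_\phi^*$. In particular, the critical amplitude $s_*$ is universal: it is independent of both the normalized profile $\phi$ and the spatial weight $k(x)$.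
   Context: $\Omega\subset\mathbb R^N$ is a bounded smooth domain, $a>0$, $k\in C(\overline\Omega)$ with $k(x)>0$ on $\overline\Omega$, and $2<q<\min\{4,2^*\}$, where $2^*=2N/(N-2)$ if $N\ge3$ and $2^*=+\infty$ if $N\le2$; $\lambda\in\mathbb R$. Solutions are weak solutions in $H_0^1(\Omega)$. A nondegenerate turning bifurcation point of a branch $s\mapsto(\lambda(s),u(s))$ of solutions is a point $(\lambda(s_* ),u(s_* ))$ with $\lambda'(s_* )=0$, $\lambda''(s_* )\neq0$, at which two branch solutions coalesce: for $\lambda$ close to $\lambda(s_* )$ on one side (below if $\lambda''(s_* )<0$, above if $\lambda''(s_* )>0$) there are two distinct solutions $u_\pm(\lambda)$ on the branch at parameter value $\lambda$, and $u_\pm(\lambda)\to u(s_* )$ as $\lambda\to\lambda(s_* )$. *)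

(* Defs.v *)
From HB Require Import structures.
From mathcomp Require Import all_boot all_order all_algebra.
From mathcomp Require Import ring lra.
From mathcomp Require Import all_classical all_reals all_analysis.
From mathcomp Require Import measurable_realfun.

Set Implicit Arguments.
Unset Strict Implicit.
Unset Printing Implicit Defensive.

Import Order.TTheory GRing.Theory Num.Theory.
Import numFieldNormedType.Exports.

Local Open Scope classical_set_scope.
Local Open Scope ring_scope.

Definition measure_rV_display : measure_display -> measure_display.
Proof. exact. Qed.

(* The sigma-algebra on row vectors generated by the coordinates: for
   'rV[R]_n it is the Borel sigma-algebra of R^n. *)
Section measurable_rV.
Context {d} {T : measurableType d}.
Variable n : nat.

Let coors : 'I_n -> 'rV[T]_n -> T := fun i v => v ord0 i.

Let rV_set0 : g_sigma_preimage coors set0.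
Proof. exact: sigma_algebra0. Qed.

Let rV_setC A : g_sigma_preimage coors A -> g_sigma_preimage coors (~` A).
Proof. exact: sigma_algebraC. Qed.

Let rV_bigcup (F : _^nat) : (forall i, g_sigma_preimage coors (F i)) ->
  g_sigma_preimage coors (\bigcup_i (F i)).
Proof. exact: sigma_algebra_bigcup. Qed.

HB.instance Definition _ := @isMeasurable.Build (measure_rV_display d)
  ('rV[T]_n) (g_sigma_preimage coors) rV_set0 rV_setC rV_bigcup.

End measurable_rV.

Lemma measurable_coor d (T : measurableType d) n (i : 'I_n) :
  measurable_fun [set: 'rV[T]_n] (fun v => v ord0 i).
Proof.
move=> _ Y mY; rewrite setTI; apply: sub_sigma_algebra => /=.
rewrite -bigcup_seq/=; exists i => /=; first by rewrite mem_index_enum.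
by exists Y => //; rewrite setTI.
Qed.

Lemma measurable_fun_rV d d' (T : measurableType d) (T' : measurableType d')
    n (f : T -> 'rV[T']_n) :
  (forall i, measurable_fun [set: T] (fun x => f x ord0 i)) ->
  measurable_fun [set: T] f.
Proof.
move=> mf.
pose S := [set A : set 'rV[T']_n | measurable (f @^-1` A)].
suff sub : measurable `<=` S by move=> _ A mA; rewrite setTI; exact: sub.
apply: smallest_sub.
  split; rewrite /S /=.
  - by rewrite preimage_set0.
  - by move=> A mA; rewrite setTD preimage_setC; exact: measurableC.
  - by move=> F mF; rewrite preimage_bigcup; exact: bigcup_measurable.
rewrite -bigcup_seq/= => A [i _ [B mB <-]].
rewrite /S /= setTI.
by have := mf i measurableT B mB; rewrite setTI.
Qed.

Section lebesgue_rV.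
Context {R : realType}.

Definition rV_cons n (p : measurableTypeR R * 'rV[R]_n) : 'rV[R]_n.+1 :=
  \row_i oapp (p.2 ord0) (p.1 : R) (unlift ord0 i).

Definition rV_tail n (v : 'rV[R]_n.+1) : 'rV[R]_n :=
  \row_i v ord0 (lift ord0 i).

Lemma measurable_rV_cons n : measurable_fun setT (@rV_cons n).
Proof.
apply: measurable_fun_rV => i.
case: (unliftP ord0 i) => [j ->|->].
  rewrite [X in measurable_fun _ X](_ : _ =
      (fun v : 'rV[R]_n => v ord0 j) \o snd).
    exact: measurableT_comp (measurable_coor j) measurable_snd.
  by apply/funext => p /=; rewrite mxE liftK.
rewrite [X in measurable_fun _ X](_ : _ = fst); first exact: measurable_fst.
by apply/funext => p /=; rewrite mxE unlift_none.
Qed.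

Lemma measurable_rV_tail n : measurable_fun [set: 'rV[R]_n.+1] (@rV_tail n).
Proof.
apply: measurable_fun_rV => i.
rewrite [X in measurable_fun _ X](_ : _ =
    (fun v : 'rV[R]_n.+1 => v ord0 (lift ord0 i))).
  exact: measurable_coor.
by apply/funext => v; rewrite mxE.
Qed.

HB.instance Definition _ n := isMeasurableFun.Build _ _ _ _
  (@rV_cons n) (@measurable_rV_cons n).

Section lebesgue_rV_step.
Variables (n : nat) (mu : {sigma_finite_measure set 'rV[R]_n -> \bar R}).

Definition lebesgue_rV_step : set 'rV[R]_n.+1 -> \bar R :=
  pushforward (lebesgue_measure \x mu)%E (@rV_cons n).

Let step0 : lebesgue_rV_step set0 = 0%E.
Proof. exact: measure0. Qed.

Let step_ge0 A : (0 <= lebesgue_rV_step A)%E.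
Proof. exact: measure_ge0. Qed.

Let step_sigma_additive : semi_sigma_additive lebesgue_rV_step.
Proof. exact: measure_semi_sigma_additive. Qed.

HB.instance Definition _ := isMeasure.Build _ _ _ lebesgue_rV_step
  step0 step_ge0 step_sigma_additive.

Let step_sigma_finite : sigma_finite setT lebesgue_rV_step.
Proof.
have [A [AT ndA Afin]] :=
  (@sigma_finiteP _ _ _ _ _).1 (sigma_finiteT (@lebesgue_measure R)).
have [B [BT ndB Bfin]] := (@sigma_finiteP _ _ _ _ _).1 (sigma_finiteT mu).
exists (fun i => [set v : 'rV[R]_n.+1 | A i (v ord0 ord0) /\ B i (rV_tail v)]).
  apply/esym/seteqP; split => // v _.
  have : [set: measurableTypeR R] (v ord0 ord0) by [].
  have : [set: 'rV[R]_n] (rV_tail v) by [].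
  rewrite AT BT => -[j _ Bj] [i _ Ai].
  exists (maxn i j) => //; split.
    by have /subsetPset := ndA _ _ (leq_maxl i j); apply.
  by have /subsetPset := ndB _ _ (leq_maxr i j); apply.
move=> i; have [mA Aoo] := Afin i; have [mB Boo] := Bfin i; split.
  apply: measurableI.
    by have := @measurable_coor _ R _ (@ord0 n) measurableT _ mA; rewrite setTI.
  by have := @measurable_rV_tail n measurableT _ mB; rewrite setTI.
rewrite /lebesgue_rV_step /pushforward (_ : _ @^-1` _ = A i `*` B i).
  by rewrite product_measure1E// lte_mul_pinfty// ge0_fin_numE.
apply/seteqP; split => -[x v] /=.
  rewrite mxE unlift_none /= => -[Ax Bv]; split => //.
  rewrite (_ : v = rV_tail (rV_cons (x, v)))//.
  by apply/rowP => j; rewrite !mxE liftK.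
move=> [Ax Bv]; split; first by rewrite mxE unlift_none.
rewrite (_ : rV_tail _ = v)//.
by apply/rowP => j; rewrite !mxE liftK.
Qed.

HB.instance Definition _ := @Measure_isSigmaFinite.Build _ _ _
  lebesgue_rV_step step_sigma_finite.

End lebesgue_rV_step.

(* Lebesgue measure on R^n: the n-fold product of the one-dimensional Lebesgue
   measure, with the one-point mass as the 0-dimensional case. *)
Fixpoint lebesgue_rV n : {sigma_finite_measure set 'rV[R]_n -> \bar R} :=
  if n is n'.+1 then lebesgue_rV_step (lebesgue_rV n')
  else \d_ (0 : 'rV[R]_0).

Lemma lebesgue_rV_box n (A : 'I_n -> set R) :
  (forall i, measurable (A i)) ->
  lebesgue_rV n [set v : 'rV[R]_n | forall i, A i (v ord0 i)] =
  (\prod_(i < n) lebesgue_measure (A i : set (measurableTypeR R)))%E.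
Proof.
elim: n A => [|n IHn] A mA.
  rewrite big_ord0 /= diracE mem_set//; by case.
rewrite big_ord_recl -(IHn (fun i => A (lift ord0 i)))//.
rewrite /= /lebesgue_rV_step /pushforward -product_measure1E//; last first.
  rewrite (_ : [set _ | _] = \bigcap_(i in [set: 'I_n])
      [set v : 'rV[R]_n | A (lift ord0 i) (v ord0 i)]).
    apply: fin_bigcap_measurable => // i _.
    by have := @measurable_coor _ R _ i measurableT _ (mA (lift ord0 i));
      rewrite setTI.
  by apply/seteqP; split => v; [move=> + i _; apply|move=> + i; apply].
  exact: (mA ord0).
congr (_ _); apply/seteqP; split => -[x v] /=.
  move=> Av; split => [|i].
    by have := Av ord0; rewrite mxE unlift_none.
  by have := Av (lift ord0 i); rewrite mxE liftK.
move=> [Ax Av] i; case: (unliftP ord0 i) => [j ->|->].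
  by rewrite mxE liftK; exact: Av.
by rewrite mxE unlift_none.
Qed.

End lebesgue_rV.

Lemma open_measurable_rV (R : realType) n (U : set 'rV[R]_n) :
  open U -> measurable U.
Proof.
move=> oU.
pose box (p : 'rV[rat]_n * 'rV[rat]_n) : set 'rV[R]_n := [set v | forall i,
  ratr (p.1 ord0 i) < v ord0 i < ratr (p.2 ord0 i)].
have mbox p : measurable (box p).
  rewrite (_ : box p = \bigcap_(i in [set: 'I_n]) [set v : 'rV[R]_n | v ord0 i \in
      `]ratr (p.1 ord0 i), ratr (p.2 ord0 i)[%R]).
    apply: fin_bigcap_measurable => // i _.
    by have := @measurable_coor _ R _ i measurableT _
      (measurable_itv `]ratr (p.1 ord0 i), ratr (p.2 ord0 i)[); rewrite setTI.
  by apply/seteqP; split => v /= vp i; have := vp i; rewrite /= in_itv//=;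
    apply.
rewrite (_ : U = \bigcup_p (if `[< box p `<=` U >] then box p else set0)).
  apply: countable_bigcupT_measurable => [|p]; first exact: countableP.
  by case: ifP.
apply/seteqP; split => [x Ux|x [p _]]; last by case: asboolP => // + px; apply.
have /nbhs_ballP[e /= e0 eU] : nbhs x U by exact: open_nbhs_nbhs.
have /choice[a aP] i : exists a : rat,
    ratr a \in `](x ord0 i - e), (x ord0 i)[%R.
  by have /rat_in_itvoo[a ?] : x ord0 i - e < x ord0 i;
    [rewrite ltrBlDr ltrDl|exists a].
have /choice[b bP] i : exists b : rat,
    ratr b \in `](x ord0 i), (x ord0 i + e)[%R.
  by have /rat_in_itvoo[b ?] : x ord0 i < x ord0 i + e;
    [rewrite ltrDl|exists b].
exists (\row_i a i, \row_i b i) => //.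
rewrite asboolT => [i|v vab].
  have := aP i; have := bP i; rewrite !in_itv/= !mxE.
  by move=> /andP[-> _] /andP[_ ->].
apply: eU; split => // j i; rewrite (ord1 j) /ball /=.
have := vab i; have := aP i; have := bP i; rewrite !in_itv/= !mxE.
move=> /andP[_ b1] /andP[a1 _] /andP[va vb].
rewrite ltr_distl; apply/andP; split; lra.
Qed.

Section smooth_functions.
Context {R : realType} {N : nat}.
Implicit Types f g : 'rV[R]_N -> R.

Definition partial (i : 'I_N) f : 'rV[R]_N -> R :=
  fun x => 'D_(delta_mx ord0 i) f x.

Definition grad f : 'rV[R]_N -> 'rV[R]_N := fun x => \row_i partial i f x.

(* C^oo: all iterated partial derivatives exist and are continuous. *)
Definition smooth f := forall l : seq 'I_N,
  continuous (foldr partial f l) /\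
  forall i x, derivable (foldr partial f l) x (delta_mx ord0 i).

Definition dotr (v w : 'rV[R]_N) : R := \sum_i v ord0 i * w ord0 i.

(* C^oo boundary: near each of its boundary points, Om is a strict sublevel set
   of a smooth function with non-vanishing gradient at that point. *)
Definition smooth_boundary (Om : set 'rV[R]_N) :=
  forall x, (closure Om `\` Om) x -> exists (U : set 'rV[R]_N) rho,
    [/\ nbhs x U, smooth rho, grad rho x != 0 &
        Om `&` U = [set y | rho y < 0] `&` U].

(* C_c^oo(Om), the functions being extended by zero outside Om. *)
Definition test_function (Om : set 'rV[R]_N) f :=
  [/\ smooth f, compact (closure [set x | f x != 0]) &
      closure [set x | f x != 0] `<=` Om].

Lemma continuous_measurable_rV f (D : set 'rV[R]_N) :
  continuous f -> measurable_fun D f.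
Proof.
move=> cf; apply: (@measurable_funS _ _ _ _ setT) => //.
apply: (measurability _ (RGenOInfty.measurableE R)) => _ [_ [x ->] <-].
rewrite setTI; apply: open_measurable_rV.
by apply: open_comp; [move=> y _; exact: cf|exact: interval_open].
Qed.

Lemma partial_scale (s : R) f l : smooth f ->
  foldr partial (fun x => s * f x) l = (fun x => s * foldr partial f l x).
Proof.
move=> sf; elim: l => //= i l ->; apply/funext => x.
by rewrite /partial; apply: deriveZ; exact: (sf l).2.
Qed.

Lemma smooth_scale (s : R) f : smooth f -> smooth (fun x => s * f x).
Proof.
move=> sf l; rewrite partial_scale//; have [cf df] := sf l; split.
  by move=> x; apply: continuousM; [exact: cst_continuous|exact: cf].
by move=> i x; apply: derivableZ; exact: df.
Qed.

Lemma test_function_scale Om (s : R) f :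
  test_function Om f -> test_function Om (fun x => s * f x).
Proof.
move=> [sf cf fO].
have sub : closure [set x | s * f x != 0] `<=` closure [set x | f x != 0].
  by apply: closureS => x /=; apply: contra => /eqP ->; rewrite mulr0.
split; first exact: smooth_scale.
- by apply: (subclosed_compact _ cf sub); exact: closed_closure.
- exact: subset_trans fO.
Qed.

End smooth_functions.

Record smooth_domain (R : realType) (N : nat) := SmoothDomain {
  dom :> set 'rV[R]_N ;
  dom_open : open dom ;
  dom_connected : connected dom ;
  dom_nonempty : dom !=set0 ;
  dom_bounded : bounded_set dom ;
  dom_smooth : smooth_boundary dom }.

Lemma measurable_dom (R : realType) (N : nat) (Om : smooth_domain R N) :
  measurable (Om : set 'rV[R]_N).
Proof. exact: open_measurable_rV (@dom_open _ _ Om). Qed.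

Section sobolev.
Context {R : realType} {N : nat}.
Variable Om : smooth_domain R N.
Local Notation mu := (@lebesgue_rV R N).

Definition square_integrable (f : 'rV[R]_N -> R) :=
  measurable_fun Om f /\ (\int[mu]_(x in Om) ((f x) ^+ 2)%:E < +oo)%E.

Definition weak_gradient (u : 'rV[R]_N -> R) (Du : 'rV[R]_N -> 'rV[R]_N) :=
  forall psi, test_function Om psi -> forall i,
    \int[mu]_(x in Om) (u x * partial i psi x) =
    - \int[mu]_(x in Om) (Du x ord0 i * psi x).

Definition in_H1 (u : 'rV[R]_N -> R) (Du : 'rV[R]_N -> 'rV[R]_N) :=
  [/\ square_integrable u,
      forall i, square_integrable (fun x => Du x ord0 i) &
      weak_gradient u Du].

(* Square of the H^1(Om) distance of u and v, given their gradients. *)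
Definition H1_sqdist (u : 'rV[R]_N -> R) (Du : 'rV[R]_N -> 'rV[R]_N)
    (v : 'rV[R]_N -> R) (Dv : 'rV[R]_N -> 'rV[R]_N) : \bar R :=
  (\int[mu]_(x in Om)
    ((u x - v x) ^+ 2 + dotr (Du x - Dv x) (Du x - Dv x))%:E)%E.

(* The closure of C_c^oo(Om) in H^1(Om). *)
Definition in_H10 (u : 'rV[R]_N -> R) (Du : 'rV[R]_N -> 'rV[R]_N) :=
  in_H1 u Du /\ exists psi : nat -> 'rV[R]_N -> R,
    (forall n, test_function Om (psi n)) /\
    H1_sqdist (psi n) (grad (psi n)) u Du @[n --> \oo] --> 0%E.

(* Elements of H_0^1(Om) are given by a representative of the function and one
   of its weak gradient (which the function determines almost everywhere); two
   of them are the same element of H_0^1(Om) when they satisfy H10_eq. *)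
Record H10 := MkH10 {
  H10_fun :> 'rV[R]_N -> R ;
  H10_grad : 'rV[R]_N -> 'rV[R]_N ;
  H10P : in_H10 H10_fun H10_grad }.

Definition H10_eq (u v : H10) := {ae mu, forall x, dom Om x -> u x = v x}.

Definition H10_neq0 (u : H10) := ~ {ae mu, forall x, dom Om x -> u x = 0}.

Definition H10_sqdist (u v : H10) : \bar R :=
  H1_sqdist u (H10_grad u) v (H10_grad v).

Let mOm := measurable_dom Om.

Let fin_num_integrable (f : 'rV[R]_N -> R) : measurable_fun Om f ->
  (\int[mu]_(x in Om) (f x)%:E)%E \is a fin_num ->
  mu.-integrable Om (EFin \o f).
Proof.
move=> mf; have mEf : measurable_fun Om (EFin \o f) by exact/measurable_EFinP.
rewrite integralE fin_numB => /andP[fp fn]; apply/integrableP; split => //.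
under eq_integral => x _ do rewrite -[(`|_|)%E]/((abse \o (EFin \o f)) x).
rewrite fune_abse ge0_integralD//=.
- by rewrite lte_add_pinfty// -ge0_fin_numE// integral_ge0.
- exact: measurable_funepos.
- exact: measurable_funeneg.
Qed.

Let Rintegral_scale (s : R) (f : 'rV[R]_N -> R) : measurable_fun Om f ->
  \int[mu]_(x in Om) (s * f x) = s * \int[mu]_(x in Om) f x.
Proof.
move=> mf; have [If|nIf] := pselect (mu.-integrable Om (EFin \o f)).
  by rewrite RintegralZl.
have [->|s0] := eqVneq s 0.
  rewrite mul0r; under eq_Rintegral do rewrite mul0r.
  by rewrite /Rintegral integral0.
have z g : ~ mu.-integrable Om (EFin \o g) -> measurable_fun Om g ->
    \int[mu]_(x in Om) g x = 0.
  move=> nIg mg; rewrite /Rintegral.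
  have : ~ (\int[mu]_(x in Om) (g x)%:E)%E \is a fin_num.
    by move=> /(fin_num_integrable mg).
  by case: (\int[mu]_(x in Om) (g x)%:E)%E.
rewrite (z f)// mulr0 z//; last exact: measurable_funM.
move=> Isf; apply: nIf.
have := integrableZl mOm s^-1 Isf.
by apply: eq_integrable => // x _ /=; rewrite -EFinM mulKf.
Qed.

Lemma in_H10_scale (s : R) u Du : in_H10 u Du ->
  in_H10 (fun x => s * u x) (fun x => s *: Du x).
Proof.
have sq f : square_integrable f -> square_integrable (fun x => s * f x).
  move=> [mf foo]; split; first exact: measurable_funM.
  under eq_integral do rewrite exprMn EFinM.
  rewrite ge0_integralZl_EFin ?sqr_ge0//; first last.
  - by apply/measurable_EFinP; exact: measurable_funX.
  - by move=> x _; rewrite lee_fin sqr_ge0.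
  by rewrite lte_mul_pinfty// lee_fin sqr_ge0.
move=> [[u2 Du2 wD] [psi [tpsi psiu]]]; split; first split.
- exact: sq.
- move=> i; rewrite [X in square_integrable X](_ : _ =
      (fun x => s * Du x ord0 i)); first exact: sq.
  by apply/funext => x; rewrite mxE.
- move=> p tp i; have [sp _ _] := tp.
  under eq_Rintegral do rewrite -mulrA.
  under [in RHS]eq_Rintegral do rewrite mxE -mulrA.
  rewrite !Rintegral_scale ?wD ?mulrN//; apply: measurable_funM.
  + exact: (Du2 i).1.
  + exact: continuous_measurable_rV (sp [::]).1.
  + exact: u2.1.
  + exact: continuous_measurable_rV (sp [:: i]).1.
exists (fun n x => s * psi n x); split=> [n|]; first exact: test_function_scale.
rewrite [X in X @ _ --> _](_ : _ = fun n =>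
    ((s ^+ 2)%:E * H1_sqdist (psi n) (grad (psi n)) u Du)%E).
  by rewrite -[X in _ --> X](mule0 (s ^+ 2)%:E); exact: cvgeZl.
apply/funext => n; have [sp _ _] := tpsi n.
rewrite /H1_sqdist -ge0_integralZl_EFin ?sqr_ge0//; first last.
- apply/measurable_EFinP; apply: measurable_funD.
    apply: measurable_funX; apply: measurable_funB; last exact: u2.1.
    exact: continuous_measurable_rV (sp [::]).1.
  apply: measurable_sum => i; apply: measurable_funM.
    rewrite [X in measurable_fun _ X](_ : _ =
        (fun x => partial i (psi n) x - Du x ord0 i)).
      apply: measurable_funB; last exact: (Du2 i).1.
      exact: continuous_measurable_rV (sp [:: i]).1.
    by apply/funext => x; rewrite !mxE.
  rewrite [X in measurable_fun _ X](_ : _ =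
      (fun x => partial i (psi n) x - Du x ord0 i)).
    apply: measurable_funB; last exact: (Du2 i).1.
    exact: continuous_measurable_rV (sp [:: i]).1.
  by apply/funext => x; rewrite !mxE.
- move=> x _; rewrite lee_fin addr_ge0 ?sqr_ge0// sumr_ge0// => i _.
  by rewrite -expr2 sqr_ge0.
apply: eq_integral => x _; rewrite -EFinM; congr (_%:E).
rewrite mulrDr -mulrBr exprMn; congr (_ + _).
rewrite /dotr mulr_sumr; apply: eq_bigr => i _; rewrite !mxE.
have -> : partial i (fun x => s * psi n x) x = s * partial i (psi n) x.
  by have := @partial_scale _ _ s _ [:: i] sp => /(congr1 (@^~ x)).
by ring.
Qed.

Definition H10_scale (s : R) (u : H10) : H10 := MkH10 (in_H10_scale s (H10P u)).

End sobolev.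

(* The Sobolev exponent 2^*. *)
Definition sobolev_exponent (R : realType) (N : nat) : \bar R :=
  if (3 <= N)%N then ((2 * N%:R) / (N%:R - 2))%:E else +oo%E.

Section kirchhoff.
Context {R : realType} {N : nat} {Om : smooth_domain R N}.
Local Notation mu := (@lebesgue_rV R N).
Implicit Types (u v phi : H10 Om) (k : 'rV[R]_N -> R) (a q l : R).

Definition grad_form u v : \bar R :=
  (\int[mu]_(x in Om) (dotr (H10_grad u x) (H10_grad v x))%:E)%E.

Definition energy u : R :=
  \int[mu]_(x in Om) dotr (H10_grad u x) (H10_grad u x).

Definition source_form k q u v : \bar R :=
  (\int[mu]_(x in Om) (k x * (`|u x| `^ (q - 2) * u x) * v x)%:E)%E.

(* The weak formulations are equalities in \bar R whose gradient side is always
   finite; they thus include the integrability of the source term. *)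
Definition profile_solution k q u :=
  forall v, grad_form u v = source_form k q u v.

Definition kirchhoff_solution a k q l u :=
  forall v, ((a + l * energy u)%:E * grad_form u v = source_form k q u v)%E.

(* A branch is a curve s |-> (lam s, w s), s ranging over S. *)
Definition on_branch (S : set R) (lam : R -> R) (w : R -> H10 Om) l u :=
  exists s, [/\ S s, l = lam s & u = w s].

Definition exactly_one (P : H10 Om -> Prop) :=
  exists u, P u /\ forall v, P v -> H10_eq v u.

Definition exactly_two (P : H10 Om -> Prop) :=
  exists u1 u2, [/\ P u1, P u2, ~ H10_eq u1 u2 &
    forall v, P v -> H10_eq v u1 \/ H10_eq v u2].

Definition turning_side (lam : R -> R) (s : R) : set_system R :=
  if 0 < derive1n 2 lam s then (lam s)^'+ else (lam s)^'-.

(* (lam s, w s) is a nondegenerate turning bifurcation point of the branch. *)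
Definition nondegenerate_turning_point (S : set R) (lam : R -> R)
    (w : R -> H10 Om) (s : R) :=
  [/\ S s, \forall t \near s, derivable lam t 1, derive1 lam s = 0,
      derivable (derive1 lam) s 1 & derive1n 2 lam s != 0] /\
  exists up um : R -> H10 Om,
    [/\ \forall l \near turning_side lam s,
          [/\ on_branch S lam w l (up l), on_branch S lam w l (um l) &
              ~ H10_eq (up l) (um l)],
        H10_sqdist (up l) (w s) @[l --> turning_side lam s] --> 0%E &
        H10_sqdist (um l) (w s) @[l --> turning_side lam s] --> 0%E].

Definition lambda_phi a q phi (s : R) : R :=
  (s `^ (q - 2) - a) / (s ^+ 2 * energy phi).

Definition s_star a q : R := (2 * a / (4 - q)) `^ (q - 2)^-1.

Definition lambda_star a q phi : R :=
  (q - 2) / (2 * energy phi) * s_star a q `^ (q - 4).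

End kirchhoff.

Arguments s_star {R} a q.

(* Main.v *)
Require Import Defs.
From mathcomp Require Import all_boot all_order all_algebra.
From mathcomp Require Import ring lra.
From mathcomp Require Import all_classical all_reals all_analysis.
From mathcomp Require Import measurable_realfun.

(** Along the ray [s |-> s phi] the Kirchhoff problem is one scalar equation.
    The energy of [s phi] is [s ^+ 2 * K] with [K := energy phi], so the left
    hand side of the weak formulation at [s phi] is
    [(a + l * s ^+ 2 * K) * s] times the gradient form of [phi], while the
    source term has degree [q - 1] and is [s `^ (q - 2) * s] times the source
    form of [phi], which equals that same gradient form.  Hence [s phi] is a
    solution as soon as [a + l * s ^+ 2 * K = s `^ (q - 2)], that is, when
    [l = lambda_phi a q phi s].  This needs [K != 0]: testing the profile
    equation with [phi] itself gives
    [K = \int k `|phi| `^ q] ([source_form_diag]), which is positive because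
    [k] is and [phi] is not zero almost everywhere ([energy_gt0]).

    What remains is the graph of
    [s |-> (s `^ (q - 2) - a) / (s ^+ 2 * K)] on [0 < s].  Its derivative is
    [K^-1 * s ^- 3 * (2 * a - (4 - q) * s `^ (q - 2))], which is positive before
    [s_star], zero at [s_star] and negative after it, and its second derivative
    at [s_star] is [2 * a * (2 - q) * K^-1 * s_star ^- 4 < 0].  The function
    comes from [-oo] at [0], increases to its maximum at [s_star], then
    decreases to [0] while staying positive.  The intermediate value theorem
    and strict monotonicity on both sides of [s_star] count the parameters [s]
    over each level [l] ([branch_nonpos], [branch_between], [branch_turning],
    [branch_beyond]).  Distinct [s] give distinct elements of H_0^1, because
    [phi] is not zero almost everywhere ([H10_scale_inj]), so that counting
    parameters counts solutions.

    At the turning point the two inverse branches of the graph are functions of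
    [l] that tend to [s_star] from below and from above as [l] increases to the
    maximum ([amplitude_parameter_fold]).  The squared H^1 distance of [s phi]
    and [t phi] is [(s - t) ^+ 2] times the squared H^1 norm of [phi], so the
    two solutions coalesce in H_0^1 ([turning_pointP]).  Only [a] and [q] enter
    [s_star], which is its universality. *)

Set Implicit Arguments.
Unset Strict Implicit.
Unset Printing Implicit Defensive.

Import Order.TTheory GRing.Theory Num.Theory.
Import numFieldNormedType.Exports.
Local Open Scope classical_set_scope.
Local Open Scope ring_scope.

(** * Level sets of a continuous function near a strict maximum *)

Lemma IVT_open {R : realType} (f : R -> R) (x y l : R) : x <= y ->
  (forall z, x <= z <= y -> {for z, continuous f}) ->
  Num.min (f x) (f y) < l < Num.max (f x) (f y) ->
  exists t, x < t < y /\ f t = l.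
Proof.
move=> xy cf /andP[l1 l2].
have [||t /[!in_itv]/= /andP[xt ty] ftl] := @IVT R f x y l xy.
- apply: continuous_in_subspaceT => z /[!inE]/= /[!in_itv]/=; exact: cf.
- by rewrite !ltW.
have ne z : z = x \/ z = y -> f z != l.
  move=> zxy; apply/eqP => fz; move: l1 l2; rewrite gt_min lt_max -fz.
  by case: zxy => ->; rewrite ltxx ?orbF /=; case: ltgtP.
exists t; split => //; rewrite !lt_neqAle xt ty !andbT; apply/andP; split.
  by apply/eqP => tE; have := ne t (or_introl (esym tE)); rewrite ftl eqxx.
by apply/eqP => tE; have := ne t (or_intror tE); rewrite ftl eqxx.
Qed.

(** Any choice of preimages below [m] converges to [m] as the level increases to
    the value at [m]: by monotonicity, the preimage of a level above [f c] lies
    beyond [c]. *)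
Lemma fold_section_left {R : realType} (f : R -> R) (b m : R) : b < m ->
  (forall x, b <= x <= m -> {for x, continuous f}) ->
  {in `[b, m] &, {homo f : x y / x < y}} ->
  exists g : R -> R, (\forall l \near (f m)^'-, b < g l < m /\ f (g l) = l) /\
    g l @[l --> (f m)^'-] --> m.
Proof.
move=> bm cf fincr.
have preim c l : b <= c < m -> f c < l < f m -> exists t, c < t < m /\ f t = l.
  move=> /andP[bc cm] /andP[cl lm]; apply: IVT_open => [|z /andP[cz zm]|].
  - exact: ltW.
  - by apply: cf; rewrite (le_trans bc).
  - by rewrite gt_min cl lt_max lm orbT.
have bI : b \in `[b, m] by rewrite in_itv/= lexx ltW.
have fbm c : b <= c < m -> f c < f m.
  by move=> /andP[bc cm]; apply: fincr => //; rewrite in_itv/= ?bc ?lexx ltW.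
have /choice[g gP] l : exists t, f b < l < f m -> b < t < m /\ f t = l.
  have [bl|nbl] := boolP (f b < l < f m); last by exists 0.
  by have [|t] := preim b l _ bl; [rewrite lexx|exists t].
have near_gt c : b <= c < m -> \forall l \near (f m)^'-, f c < l < f m.
  move=> /fbm cm; near=> l; apply/andP; split.
    by near: l; exact: nbhs_left_gt.
  by near: l; exact: nbhs_left_lt.
have gP' : \forall l \near (f m)^'-, b < g l < m /\ f (g l) = l.
  by apply: filterS gP _; apply: near_gt; rewrite lexx.
exists g; split => //; apply/cvgrPdist_lt => e e0.
pose c := Num.max b (m - e).
have bcm : b <= c < m by rewrite le_max lexx gt_max bm ltrBlDr ltrDl.
near=> l.
have [/andP[bg gm] fg] : b < g l < m /\ f (g l) = l by near: l.
have /andP[cl _] : f c < l < f m by near: l; exact: near_gt.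
have cg : c < g l.
  rewrite ltNge; apply/negP; rewrite le_eqVlt => /predU1P[E|gc].
    by rewrite -E fg ltxx in cl.
  move: cl; rewrite -fg ltNge ltW//; apply: fincr => //.
    by rewrite in_itv/= !ltW.
  by have /andP[bc cm] := bcm; rewrite in_itv/= bc ltW.
rewrite gtr0_norm ?subr_gt0// ltrBlDr -ltrBlDl (le_lt_trans _ cg)//.
by rewrite le_max lexx orbT.
Unshelve. all: by end_near. Qed.

(** The reflection [x |-> - x] exchanges the two sides of the maximum. *)
Lemma fold_section_right {R : realType} (f : R -> R) (m b : R) : m < b ->
  (forall x, m <= x <= b -> {for x, continuous f}) ->
  {in `[m, b] &, {homo f : x y /~ x < y}} ->
  exists g : R -> R, (\forall l \near (f m)^'-, m < g l < b /\ f (g l) = l) /\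
    g l @[l --> (f m)^'-] --> m.
Proof.
move=> mb cf fdecr.
have [|x xI|x y|g] := @fold_section_left R (f \o -%R) (- b) (- m).
- by rewrite ltrN2.
- apply: continuous_comp; first exact: opp_continuous.
  by apply: cf; rewrite lerNr lerNl andbC.
- rewrite !in_itv/= => xI yI xy; apply: fdecr; rewrite ?ltrN2// in_itv/=;
    by rewrite lerNr lerNl andbC.
rewrite /= opprK => -[gP gm]; exists (-%R \o g); split.
  by apply: filterS gP => l /= [gI ->]; rewrite ltrNr ltrNl andbC.
by rewrite -[X in _ --> X]opprK; exact: cvgN.
Qed.

(** * The parameter as a function of the amplitude *)

Lemma powR_subn {R : realType} (s r : R) n : 0 < s ->
  s `^ (r - n%:R) = s `^ r / s ^+ n.
Proof.
by move=> s0; rewrite powRB ?(gt_eqF s0) ?implybT// powR_mulrn// ltW.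
Qed.

(** The function [lambda_phi], which depends on the profile only through its
    energy [K]. *)
Definition amplitude_parameter {R : realType} (a q K s : R) : R :=
  (s `^ (q - 2) - a) / (s ^+ 2 * K).

Section amplitude.
Variables (R : realType) (a q K : R).
Variables (a_gt0 : 0 < a) (q_gt2 : 2 < q) (q_lt4 : q < 4) (K_gt0 : 0 < K).
Local Notation f := (amplitude_parameter a q K).
Local Notation m := (s_star a q).

(** The first two derivatives, as sums of powers: the form in which the power
    rule applies again. *)
Let d1 (s : R) := K^-1 * ((q - 4) * s `^ (q - 5) + 2 * a * s `^ (- 3)).
Let d2 (s : R) :=
  K^-1 * ((q - 4) * (q - 5) * s `^ (q - 6) - 6 * a * s `^ (- 4)).

Lemma s_star_gt0 : 0 < m.
Proof. by apply: powR_gt0; apply: divr_gt0; rewrite ?mulr_gt0// subr_gt0. Qed.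

Lemma s_star_powR : m `^ (q - 2) = 2 * a / (4 - q).
Proof.
rewrite -powRrM mulVf ?powRr1 ?subr_eq0 ?gt_eqF//.
by apply/ltW/divr_gt0; rewrite ?mulr_gt0// subr_gt0.
Qed.

Lemma powR_lt_s_star s : 0 < s -> (s `^ (q - 2) < 2 * a / (4 - q)) = (s < m).
Proof.
move=> s0; have m0 := s_star_gt0; rewrite -s_star_powR; apply/idP/idP.
  apply: contraTT; rewrite -!leNgt; apply: ge0_ler_powR.
  - by rewrite subr_ge0 ltW.
  - by rewrite nnegrE ltW.
  - by rewrite nnegrE ltW.
by apply: gt0_ltr_powR; rewrite ?subr_gt0// nnegrE ltW.
Qed.

Lemma amplitude_parameterE s : 0 < s ->
  f s = K^-1 * (s `^ (q - 4) - a * s `^ (- 2)).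
Proof.
move=> s0; rewrite (_ : q - 4 = q - 2 - 2); last by ring.
rewrite powR_subn// powR_invn ?ltW// /amplitude_parameter.
by field; rewrite !gt_eqF.
Qed.

(** The factored form of the derivative, in which the sign is that of
    [s_star - s]. *)
Lemma d1E s : 0 < s ->
  d1 s = K^-1 * s ^- 3 * (2 * a - (4 - q) * s `^ (q - 2)).
Proof.
move=> s0; rewrite /d1 (_ : q - 5 = q - 2 - 3); last by ring.
by rewrite powR_subn// powR_invn ?ltW//; field; rewrite !gt_eqF.
Qed.

Lemma d2_s_star : d2 m < 0.
Proof.
have m0 := s_star_gt0.
(* At [s_star], [s `^ (q - 2)] is [2 * a / (4 - q)], which turns
   [(q - 4) * (q - 5) * s `^ (q - 2) - 6 * a] into [2 * a * (2 - q)]. *)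
rewrite /d2 (_ : q - 6 = q - 2 - 4); last by ring.
rewrite powR_subn// powR_invn ?ltW// s_star_powR.
rewrite [ltLHS](_ : _ = K^-1 * m ^- 4 * (2 * a * (2 - q))).
  rewrite pmulr_rlt0 ?mulr_gt0 ?invr_gt0 ?exprn_gt0//.
  by rewrite pmulr_rlt0 ?mulr_gt0// subr_lt0.
by field; rewrite !gt_eqF// subr_gt0.
Qed.

Lemma is_derive_amplitude_parameter (s : R) : 0 < s -> is_derive s 1 f (d1 s).
Proof.
move=> s0.
apply: (@near_eq_is_derive _ _ _
  (K^-1 \*: ((@powR R ^~ (q - 4)) - a \*: (@powR R ^~ (- 2))) : R -> R)).
  by near=> t; rewrite amplitude_parameterE//=; near: t; exact: lt_nbhsr.
have H4 := @is_derive1_powR R (q - 4) s s0.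
have H2 := @is_derive1_powR R (- 2) s s0.
apply: is_derive_eq; rewrite /d1 /GRing.scale/=; congr (_ * _).
rewrite (_ : q - 4 - 1 = q - 5); last by ring.
rewrite (_ : - 2 - 1 = - 3 :> R); last by ring.
by ring.
Unshelve. all: by end_near. Qed.

Lemma is_derive2_amplitude_parameter (s : R) : 0 < s ->
  is_derive s 1 (derive1 f) (d2 s).
Proof.
move=> s0.
apply: (@near_eq_is_derive _ _ _ (K^-1 \*:
  ((q - 4) \*: (@powR R ^~ (q - 5)) + (2 * a) \*: (@powR R ^~ (- 3)))
    : R -> R)).
  near=> t; have t0 : 0 < t by near: t; exact: lt_nbhsr.
  by have [_ dft] := is_derive_amplitude_parameter t0; rewrite derive1E dft.
have H4 := @is_derive1_powR R (q - 5) s s0.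
have H2 := @is_derive1_powR R (- 3) s s0.
apply: is_derive_eq; rewrite /d2 /GRing.scale/=; congr (_ * _).
rewrite (_ : q - 5 - 1 = q - 6); last by ring.
rewrite (_ : - 3 - 1 = - 4 :> R); last by ring.
by ring.
Unshelve. all: by end_near. Qed.

Lemma amplitude_parameter_continuous (s : R) : 0 < s -> {for s, continuous f}.
Proof.
move=> /is_derive_amplitude_parameter[df _].
exact/differentiable_continuous/derivable1_diffP.
Qed.

Lemma amplitude_parameter_derive_gt0 (s : R) : 0 < s < m -> 0 < derive1 f s.
Proof.
move=> /andP[s0 sm]; have [_ dfs] := is_derive_amplitude_parameter s0.
rewrite derive1E dfs d1E// mulr_gt0 ?mulr_gt0 ?invr_gt0 ?exprn_gt0//.
by rewrite subr_gt0 mulrC -ltr_pdivlMr ?subr_gt0// powR_lt_s_star.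
Qed.

Lemma amplitude_parameter_derive_lt0 (s : R) : m < s -> derive1 f s < 0.
Proof.
move=> ms; have s0 := lt_trans s_star_gt0 ms.
have [_ dfs] := is_derive_amplitude_parameter s0.
rewrite derive1E dfs d1E// pmulr_rlt0 ?mulr_gt0 ?invr_gt0 ?exprn_gt0//.
rewrite subr_lt0 (mulrC (4 - q)) -ltr_pdivrMr ?subr_gt0// -s_star_powR.
by apply: gt0_ltr_powR; rewrite ?subr_gt0// nnegrE ltW// s_star_gt0.
Qed.

Lemma amplitude_parameter_derive_eq0 (s : R) : 0 < s ->
  derive1 f s = 0 <-> s = m.
Proof.
move=> s0; split=> [/eqP|->].
  have [sm|ms|//] := ltgtP s m.
    by rewrite gt_eqF// amplitude_parameter_derive_gt0// s0.
  by rewrite lt_eqF// amplitude_parameter_derive_lt0.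
have m0 := s_star_gt0; have [_ dfs] := is_derive_amplitude_parameter m0.
by rewrite derive1E dfs d1E// s_star_powR; field; rewrite !gt_eqF// subr_gt0.
Qed.

Lemma amplitude_parameter_derive2_lt0 : derive1n 2 f m < 0.
Proof.
have [_ d2f] := is_derive2_amplitude_parameter s_star_gt0.
by rewrite /derive1n/= derive1E d2f d2_s_star.
Qed.

Lemma amplitude_parameter_incr x y : 0 < x -> x < y -> y <= m -> f x < f y.
Proof.
move=> x0 xy ym; apply: (@gtr0_derive1_lt_cc R f x y) => //.
- move=> z /[!in_itv]/= /andP[xz zy].
  by have [] := is_derive_amplitude_parameter (lt_trans x0 xz).
- move=> z /[!in_itv]/= /andP[xz zy].
  by rewrite amplitude_parameter_derive_gt0// (lt_trans x0 xz) (lt_le_trans zy).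
- apply: continuous_in_subspaceT => z /[!inE]/= /[!in_itv]/= /andP[xz _].
  by apply: amplitude_parameter_continuous; exact: lt_le_trans xz.
- by rewrite in_itv/= lexx ltW.
- by rewrite in_itv/= lexx ltW.
Qed.

Lemma amplitude_parameter_decr x y : m <= x -> x < y -> f y < f x.
Proof.
move=> mx xy; have m0 := s_star_gt0.
apply: (@ltr0_derive1_lt_cc R f x y) => //.
- move=> z /[!in_itv]/= /andP[xz zy].
  by have [] := is_derive_amplitude_parameter
    (lt_trans (lt_le_trans m0 mx) xz).
- move=> z /[!in_itv]/= /andP[xz _].
  exact/amplitude_parameter_derive_lt0/(le_lt_trans mx).
- apply: continuous_in_subspaceT => z /[!inE]/= /[!in_itv]/= /andP[xz _].
  apply: amplitude_parameter_continuous.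
  exact: lt_le_trans m0 (le_trans mx xz).
- by rewrite in_itv/= lexx ltW.
- by rewrite in_itv/= lexx ltW.
Qed.

Lemma amplitude_parameter_s_star :
  f m = (q - 2) / (2 * K) * m `^ (q - 4).
Proof.
have m0 := s_star_gt0.
rewrite (_ : q - 4 = q - 2 - 2); last by ring.
rewrite powR_subn// /amplitude_parameter s_star_powR.
by field; rewrite !gt_eqF// subr_gt0.
Qed.

(** From [s_star] on, [s `^ (q - 2)] is at least [2 * a / (4 - q)], which
    exceeds [a] because [2 < q]: all solutions with [l <= 0] are thus on the
    increasing part of the graph. *)
Lemma amplitude_parameter_gt0 s : m <= s -> 0 < f s.
Proof.
move=> ms; have s0 := lt_le_trans s_star_gt0 ms.
rewrite divr_gt0 ?mulr_gt0 ?exprn_gt0// subr_gt0.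
rewrite (@lt_le_trans _ _ (2 * a / (4 - q)))//.
  by rewrite ltr_pdivlMr ?subr_gt0// (mulrC 2) ltr_pM2l//; move: q_gt2; lra.
by rewrite leNgt powR_lt_s_star// -leNgt.
Qed.

Lemma amplitude_parameter_lt_max s : 0 < s -> s != m -> f s < f m.
Proof.
move=> s0; rewrite neq_lt => /orP[sm|ms].
  exact: amplitude_parameter_incr.
exact: amplitude_parameter_decr.
Qed.

(** The limit [-oo] at [0], in the form needed for the intermediate value
    theorem. *)
Lemma amplitude_parameter_small l : exists t, 0 < t < m /\ f t < l.
Proof.
(* The first bound makes the numerator at most [- a / 2], the second the
   denominator at most [a / (2 * (`|l| + 1))]. *)
pose t := Num.min ((a / 2) `^ (q - 2)^-1)
  (Num.sqrt (a / (2 * (K * (`|l| + 1))))).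
have a2 : 0 < a / 2 by rewrite divr_gt0.
have l1 : 0 < `|l| + 1 by rewrite ltr_wpDl.
have c0 : 0 < a / (2 * (K * (`|l| + 1))) by rewrite divr_gt0 ?mulr_gt0.
have t0 : 0 < t by rewrite lt_min powR_gt0// sqrtr_gt0.
have tq : t `^ (q - 2) <= a / 2.
  have -> : a / 2 = ((a / 2) `^ (q - 2)^-1) `^ (q - 2).
    by rewrite -powRrM mulVf ?powRr1 ?(ltW a2)// gt_eqF// subr_gt0.
  apply: ge0_ler_powR; rewrite ?nnegrE ?powR_ge0 ?(ltW t0)//.
    by rewrite subr_ge0 ltW.
  by rewrite ge_min lexx.
have t2 : t ^+ 2 <= a / (2 * (K * (`|l| + 1))).
  rewrite -[leRHS](sqr_sqrtr (ltW c0)) ler_sqr ?nnegrE ?(ltW t0) ?sqrtr_ge0//.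
  by rewrite ge_min lexx orbT.
have tl : f t <= - (`|l| + 1).
  rewrite ler_pdivrMr ?mulr_gt0 ?exprn_gt0//.
  move: t2; rewrite ler_pdivlMr ?mulr_gt0// => t2.
  rewrite (_ : - _ * _ = - (t ^+ 2 * (2 * (K * (`|l| + 1)))) / 2); first lra.
  by field.
exists t; rewrite t0/=; split; last first.
  apply: (le_lt_trans tl); rewrite ltrNl (le_lt_trans (ler_norm _))//.
  by rewrite normrN ltrDl.
rewrite ltNge; apply/negP => /amplitude_parameter_gt0; rewrite ltNge.
by rewrite (le_trans tl)// oppr_le0 ltW.
Qed.

(** The limit [0] at infinity, from
    [amplitude_parameter a q K s < K^-1 * s `^ (q - 4)] and [q < 4]. *)
Lemma amplitude_parameter_large l : 0 < l -> exists t, m < t /\ f t < l.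
Proof.
move=> l0; have m0 := s_star_gt0.
(* [T] solves [K^-1 * T `^ (q - 4) = l]. *)
pose T := (l * K) `^ (q - 4)^-1; pose t := Num.max (m + 1) T.
have lK : 0 < l * K by rewrite mulr_gt0.
have T0 : 0 < T by rewrite powR_gt0.
have mt : m < t by rewrite lt_max ltrDl ltr01.
have t0 := lt_trans m0 mt.
exists t; split => //; rewrite amplitude_parameterE//.
rewrite ltr_pdivrMl// (mulrC K) (@lt_le_trans _ _ (t `^ (q - 4)))//.
  by rewrite ltrBlDr ltrDl mulr_gt0// powR_gt0.
have -> : l * K = T `^ (q - 4).
  by rewrite -powRrM mulVf ?powRr1 ?(ltW lK)// lt_eqF// subr_lt0.
rewrite -(opprB 4 q) !powRN lef_pV2 ?posrE ?powR_gt0//.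
apply: ge0_ler_powR; rewrite ?nnegrE ?(ltW t0) ?(ltW T0)//.
  by rewrite subr_ge0 ltW.
by rewrite le_max lexx orbT.
Qed.

Lemma amplitude_parameter_IVT x y l : 0 < x -> x <= y ->
  Num.min (f x) (f y) < l < Num.max (f x) (f y) ->
  exists t, x < t < y /\ f t = l.
Proof.
move=> x0 xy; apply: IVT_open => // z /andP[xz _].
by apply: amplitude_parameter_continuous; exact: lt_le_trans xz.
Qed.

Lemma amplitude_parameter_left l : l < f m -> exists t, 0 < t < m /\ f t = l.
Proof.
move=> lm; have [t [/andP[t0 tm] tl]] := amplitude_parameter_small l.
have [|u [/andP[tu um] ful]] := @amplitude_parameter_IVT t m l t0 (ltW tm).
  by rewrite gt_min tl lt_max lm orbT.
by exists u; rewrite (lt_trans t0).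
Qed.

Lemma amplitude_parameter_right l : 0 < l < f m -> exists t, m < t /\ f t = l.
Proof.
move=> /andP[l0 lm]; have [t [mt tl]] := amplitude_parameter_large l0.
have [|u [/andP[tu um] ful]] :=
    @amplitude_parameter_IVT m t l s_star_gt0 (ltW mt).
  by rewrite gt_min tl lt_max lm orbT.
by exists u.
Qed.

Lemma amplitude_parameter_inj_left x y :
  0 < x <= m -> 0 < y <= m -> f x = f y -> x = y.
Proof.
move=> /andP[x0 xm] /andP[y0 ym] fxy; have [xy|yx|//] := ltgtP x y.
  by have := amplitude_parameter_incr x0 xy ym; rewrite fxy ltxx.
by have := amplitude_parameter_incr y0 yx xm; rewrite fxy ltxx.
Qed.

Lemma amplitude_parameter_inj_right x y :
  m <= x -> m <= y -> f x = f y -> x = y.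
Proof.
move=> mx my fxy; have [xy|yx|//] := ltgtP x y.
  by have := amplitude_parameter_decr mx xy; rewrite fxy ltxx.
by have := amplitude_parameter_decr my yx; rewrite fxy ltxx.
Qed.

(** The two inverse branches of the graph near its maximum, the analytic content
    of a nondegenerate turning point. *)
Lemma amplitude_parameter_fold : exists gp gm : R -> R,
  [/\ \forall l \near (f m)^'-,
        [/\ 0 < gm l < m, m < gp l, f (gp l) = l & f (gm l) = l],
      gp l @[l --> (f m)^'-] --> m & gm l @[l --> (f m)^'-] --> m].
Proof.
have m0 := s_star_gt0; have m2 : 0 < m / 2 by rewrite divr_gt0.
have [||x y|gm [gmP gmm]] := @fold_section_left R f (m / 2) m.
- by rewrite ltr_pdivrMr// ltr_pMr// ltrDl ltr01.
- move=> x /andP[mx _]; apply: amplitude_parameter_continuous.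
  exact: lt_le_trans mx.
- rewrite !in_itv/= => /andP[mx _] /andP[_ ym] xy.
  by apply: amplitude_parameter_incr => //; exact: lt_le_trans mx.
have [||x y|gp [gpP gpm]] := @fold_section_right R f m (m + 1).
- by rewrite ltrDl ltr01.
- move=> x /andP[mx _]; apply: amplitude_parameter_continuous.
  exact: lt_le_trans mx.
- rewrite !in_itv/= => /andP[mx _] /andP[my _] xy.
  exact: amplitude_parameter_decr.
exists gp, gm; split => //.
apply: filterS2 gmP gpP => l [/andP[ml gl] fgm] [/andP[mg _] fgp].
by split => //; rewrite (lt_trans m2).
Qed.

End amplitude.

(** * Integrals of real functions *)

(** The positive and negative parts have nonnegative integrals whose difference
    is finite, so both are finite. *)
Lemma integral_fin_num_integrable d (T : measurableType d) (R : realType)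
    (mu : {measure set T -> \bar R}) (D : set T) (f : T -> R) :
  measurable D -> measurable_fun D f ->
  (\int[mu]_(x in D) (f x)%:E)%E \is a fin_num ->
  mu.-integrable D (EFin \o f).
Proof.
move=> mD mf; have mEf : measurable_fun D (EFin \o f) by exact/measurable_EFinP.
rewrite integralE fin_numB => /andP[fp fn]; apply/integrableP; split => //.
under eq_integral => x _ do rewrite -[(`|_|)%E]/((abse \o (EFin \o f)) x).
rewrite fune_abse ge0_integralD//=.
- by rewrite lte_add_pinfty// -ge0_fin_numE// integral_ge0.
- exact: measurable_funepos.
- exact: measurable_funeneg.
Qed.

(** * Scaling in H_0^1 *)

Section H10_theory.
Variables (R : realType) (N : nat) (Om : smooth_domain R N).
Local Notation mu := (@lebesgue_rV R N).
Implicit Types (u v : H10 Om) (f g k : 'rV[R]_N -> R).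

Let mOm := measurable_dom Om.

Lemma square_integrable_sqr f : square_integrable Om f ->
  mu.-integrable Om (fun x => (f x ^+ 2)%:E).
Proof.
move=> [mf foo]; apply/integrableP; split.
  by apply/measurable_EFinP; exact: measurable_funX.
by under eq_integral do rewrite gee0_abs ?lee_fin ?sqr_ge0//.
Qed.

(** Domination by [f ^+ 2 + g ^+ 2]. *)
Lemma square_integrable_mul f g :
  square_integrable Om f -> square_integrable Om g ->
  mu.-integrable Om (fun x => (f x * g x)%:E).
Proof.
move=> sf sg.
apply: (le_integrable mOm _ _ (integrableD mOm (square_integrable_sqr sf)
  (square_integrable_sqr sg))).
  by apply/measurable_EFinP; apply: measurable_funM; [exact: sf.1|exact: sg.1].
move=> x _ /=; rewrite lee_fin normrM [leRHS]ger0_norm ?addr_ge0 ?sqr_ge0//.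
rewrite -(real_normK (num_real (f x))) -(real_normK (num_real (g x))).
have := mulr_ge0 (normr_ge0 (f x)) (normr_ge0 (g x)).
have := sqr_ge0 (`|f x| - `|g x|).
rewrite sqrrB; lra.
Qed.

Lemma H10_square_integrable u : square_integrable Om u.
Proof. by have [[]] := H10P u. Qed.

Lemma H10_grad_square_integrable u i :
  square_integrable Om (fun x => H10_grad u x ord0 i).
Proof. by have [[_ + _] _] := H10P u; exact. Qed.

Lemma dotr_integrable u v :
  mu.-integrable Om (fun x => (dotr (H10_grad u x) (H10_grad v x))%:E).
Proof.
rewrite [X in _.-integrable _ X](_ : _ = (fun x =>
    \sum_i (H10_grad u x ord0 i * H10_grad v x ord0 i)%:E)%E).
  by apply: integrable_sum => // i _; apply: square_integrable_mul;
    exact: H10_grad_square_integrable.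
by apply/funext => x; rewrite sumEFin.
Qed.

Lemma dotrv_ge0 (v : 'rV[R]_N) : 0 <= dotr v v.
Proof. by apply: sumr_ge0 => i _; rewrite -expr2 sqr_ge0. Qed.

Lemma dotrZl (s : R) (v w : 'rV[R]_N) : dotr (s *: v) w = s * dotr v w.
Proof.
by rewrite /dotr mulr_sumr; apply: eq_bigr => i _; rewrite mxE mulrA.
Qed.

Lemma dotrZr (s : R) (v w : 'rV[R]_N) : dotr v (s *: w) = s * dotr v w.
Proof.
by rewrite /dotr mulr_sumr; apply: eq_bigr => i _; rewrite mxE mulrCA.
Qed.

Lemma grad_form_fin_num u v : grad_form u v \is a fin_num.
Proof. exact/integrable_fin_num/dotr_integrable. Qed.

Lemma energyE u : (energy u)%:E = grad_form u u.
Proof. by rewrite fineK// grad_form_fin_num. Qed.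

Lemma energy_ge0 u : 0 <= energy u.
Proof. by apply: Rintegral_ge0 => x _; exact: dotrv_ge0. Qed.

Lemma grad_form_scale (s : R) u v :
  grad_form (H10_scale s u) v = (s%:E * grad_form u v)%E.
Proof.
rewrite -integralZl//; last exact: dotr_integrable.
by apply: eq_integral => x _; rewrite -EFinM -dotrZl.
Qed.

Lemma energy_scale (s : R) u : energy (H10_scale s u) = s ^+ 2 * energy u.
Proof.
rewrite /energy -RintegralZl//; last exact: dotr_integrable.
by apply: eq_Rintegral => x _; rewrite /= dotrZl dotrZr mulrA.
Qed.

Definition H1_sqnorm u : \bar R :=
  (\int[mu]_(x in Om) (u x ^+ 2 + dotr (H10_grad u x) (H10_grad u x))%:E)%E.

Let H1_sqnorm_integrable u : mu.-integrable Om
  (fun x => (u x ^+ 2 + dotr (H10_grad u x) (H10_grad u x))%:E).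
Proof.
under eq_fun do rewrite EFinD; apply: integrableD => //.
  exact/square_integrable_sqr/H10_square_integrable.
exact: dotr_integrable.
Qed.

Lemma H1_sqnorm_fin_num u : H1_sqnorm u \is a fin_num.
Proof. exact/integrable_fin_num/H1_sqnorm_integrable. Qed.

Lemma H10_sqdist_scale (s t : R) u :
  H10_sqdist (H10_scale s u) (H10_scale t u) =
    (((s - t) ^+ 2)%:E * H1_sqnorm u)%E.
Proof.
rewrite -integralZl//.
apply: eq_integral => x _; rewrite -EFinM; congr (_%:E).
by rewrite /= -mulrBl -scalerBl dotrZl dotrZr mulrDr exprMn mulrA.
Qed.

Lemma H10_scale_cvg (F : set_system R) (FF : ProperFilter F) (g : R -> R)
    (s : R) u : g l @[l --> F] --> s ->
  H10_sqdist (H10_scale (g l) u) (H10_scale s u) @[l --> F] --> 0%E.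
Proof.
move=> gs; under eq_fun do
  rewrite H10_sqdist_scale -(fineK (H1_sqnorm_fin_num u)).
under eq_fun do rewrite -EFinM.
apply: cvg_EFin; first exact: nearW.
rewrite [X in _ --> X](_ : _ = (s - s) ^+ 2 * fine (H1_sqnorm u)); last first.
  by rewrite subrr expr0n mul0r.
apply: cvgM; last exact: cvg_cst.
by rewrite expr2; apply: cvgM; apply: cvgB => //; exact: cvg_cst.
Qed.

(** If [s != t], then [(s - t) * u = 0] forces [u = 0] almost everywhere. *)
Lemma H10_scale_inj (s t : R) u : H10_neq0 u ->
  H10_eq (H10_scale s u) (H10_scale t u) -> s = t.
Proof.
move=> u0 st; apply/eqP/negPn/negP => nst; apply: u0.
apply: filterS st => x /= + Ox => /(_ Ox) /eqP.
by rewrite -subr_eq0 -mulrBl mulf_eq0 subr_eq0 (negbTE nst)/= => /eqP.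
Qed.

Lemma H10_eqxx u : H10_eq u u.
Proof. exact: aeW. Qed.

(** Relative to the open set [Om], the preimage of an open set is open. *)
Lemma within_closure_measurable k :
  {within closure (dom Om), continuous k} -> measurable_fun Om k.
Proof.
move=> /(continuous_subspaceW (@subset_closure _ (dom Om))).
rewrite continuous_open_subspace; last exact: dom_open.
move=> ck _.
apply: (measurability _ (RGenOInfty.measurableE R)) => //_ [_ [x ->] <-].
apply: open_measurable_rV.
rewrite openE => y [Oy ky]; apply: filterI.
  exact/open_nbhs_nbhs/(conj (@dom_open _ _ Om)).
apply: (ck y); first exact/mem_set.
by apply: open_nbhs_nbhs; split => //; exact: interval_open.
Qed.

(** * The source term *)

Section source_term.
Variables (k : 'rV[R]_N -> R) (q : R).
Variables (k_cont : {within closure (dom Om), continuous k})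
  (k_gt0 : forall x, closure (dom Om) x -> 0 < k x) (q_gt2 : 2 < q).

Let mk : measurable_fun Om k := within_closure_measurable k_cont.

Lemma powR_norm_sqr (x r : R) : 2 < r -> `|x| `^ (r - 2) * x * x = `|x| `^ r.
Proof.
move=> r2; rewrite -mulrA -expr2 -real_normK ?num_real//.
have [->|x0] := eqVneq x 0.
  rewrite normr0 expr0n mulr0 powR0//; lra.
rewrite -powR_mulrn// -powRD ?subrK//.
by rewrite normr_eq0 x0 implybT.
Qed.

Lemma measurable_source u v : measurable_fun Om
  (fun x => k x * (`|u x| `^ (q - 2) * u x) * v x).
Proof.
have mu' := (H10_square_integrable u).1; have mv := (H10_square_integrable v).1.
apply: measurable_funM => //; apply: measurable_funM => //.
apply: measurable_funM => //.
apply: (measurableT_comp (measurable_powR _)) => //.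
exact: measurableT_comp.
Qed.

Lemma source_form_diag u : source_form k q u u =
  (\int[mu]_(x in Om) (k x * `|u x| `^ q)%:E)%E.
Proof.
apply: eq_integral => x _.
by rewrite -!mulrA [_ * (u x * _)]mulrA powR_norm_sqr.
Qed.

(** Finiteness of the source form makes its integrand integrable, without which
    constants need not move out of the integral; for a solution it holds since
    the gradient form is finite. *)
Lemma source_form_scale (s : R) u v : 0 < s ->
  source_form k q u v \is a fin_num ->
  source_form k q (H10_scale s u) v =
    ((s `^ (q - 2) * s)%:E * source_form k q u v)%E.
Proof.
move=> s0 fin; rewrite -integralZl//; last first.
  by apply: integral_fin_num_integrable => //; exact: measurable_source.
apply: eq_integral => x _; rewrite -EFinM; congr (_%:E) => /=.
by rewrite normrM gtr0_norm// powRM// ?ltW//; ring.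
Qed.

(** If the energy vanished, so would the integral of [k * `|u| `^ q], a
    nonnegative function that is zero only where [u] is. *)
Lemma energy_gt0 u : H10_neq0 u -> profile_solution k q u -> 0 < energy u.
Proof.
move=> u0 usol; rewrite lt_neqAle energy_ge0 andbT eq_sym; apply/eqP => E0.
apply: u0.
have kuE : (\int[mu]_(x in Om) `|(k x * `|u x| `^ q)%:E| = 0)%E.
  rewrite -[RHS]/(0%:E) -E0 energyE usol source_form_diag.
  apply: eq_integral => x /[!inE] Ox; rewrite gee0_abs// lee_fin.
  by rewrite mulr_ge0 ?powR_ge0// ltW// k_gt0//; exact: subset_closure.
have mku : measurable_fun Om (fun x => (k x * `|u x| `^ q)%:E).
  apply/measurable_EFinP; apply: measurable_funM => //.
  apply: (measurableT_comp (measurable_powR _)) => //.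
  by apply: measurableT_comp => //; exact: (H10_square_integrable u).1.
have /(ae_eq_integral_abs mu mOm mku) := kuE.
apply: filterS => x /= + Ox => /(_ Ox) /eqP.
rewrite eqe mulf_eq0 gt_eqF/=; last exact/k_gt0/subset_closure.
by move=> /eqP/powR_eq0_eq0/normr0_eq0.
Qed.

End source_term.
End H10_theory.

(** * The branch through a profile *)

Section scaling_branch.
Variables (R : realType) (N : nat) (Om : smooth_domain R N) (a q : R).
Variables (a_gt0 : 0 < a) (q_gt2 : 2 < q) (q_lt4 : q < 4).
Variables (phi : H10 Om) (phi_neq0 : H10_neq0 phi).
Variable energy_phi_gt0 : 0 < energy phi.

Local Notation lam := (lambda_phi a q phi).
Local Notation w := (fun s : R => H10_scale s phi).
Local Notation S := [set s : R | 0 < s].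
Local Notation Gamma := (on_branch S lam w).
Local Notation m := (s_star a q).

Lemma scaling_branch_solution (k : 'rV[R]_N -> R) (s : R) :
  {within closure (dom Om), continuous k} -> profile_solution k q phi ->
  0 < s -> kirchhoff_solution a k q (lam s) (w s).
Proof.
move=> ck phi_sol s0 v.
rewrite source_form_scale// -?phi_sol ?grad_form_fin_num// grad_form_scale.
rewrite muleA -EFinM energy_scale; congr (_%:E * _)%E; congr (_ * _).
by rewrite /lambda_phi; field; rewrite !gt_eqF.
Qed.

(** A turning point is a critical point of the parameter, hence [s_star]. At
    [s_star] the second derivative is negative, so the solutions on the two
    inverse branches are sought below the maximum. *)
Lemma turning_pointP (s : R) :
  nondegenerate_turning_point S lam w s <-> s = m.
Proof.
have m0 := s_star_gt0 a_gt0 q_lt4.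
split=> [[[s0 _ ds0 _ _] _]|->].
  by apply/(@amplitude_parameter_derive_eq0 _ a q (energy phi)).
have d2m := amplitude_parameter_derive2_lt0 a_gt0 q_gt2 q_lt4 energy_phi_gt0.
split.
  split => //.
  - near=> t; have t0 : 0 < t by near: t; exact: lt_nbhsr.
    by have [] := @is_derive_amplitude_parameter _ a q _ energy_phi_gt0 t t0.
  - exact/amplitude_parameter_derive_eq0.
  - by have [] := @is_derive2_amplitude_parameter _ a q _ energy_phi_gt0 m m0.
  - by rewrite lt_eqF.
have [gp [gm [gP gpm gmm]]] := amplitude_parameter_fold
  a_gt0 q_gt2 q_lt4 energy_phi_gt0.
have -> : turning_side lam m = (lam m)^'-.
  by rewrite /turning_side; case: ifP => // /lt_trans/(_ d2m); rewrite ltxx.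
exists (w \o gp), (w \o gm); split.
- apply: filterS gP => l [/andP[gm0 gml] gpl fgp fgm]; split.
  + by exists (gp l); split => //; exact: lt_trans gpl.
  + by exists (gm l).
  + by move=> /(H10_scale_inj phi_neq0) E; move: (lt_trans gml gpl);
      rewrite E ltxx.
- exact: H10_scale_cvg.
- exact: H10_scale_cvg.
Unshelve. all: by end_near. Qed.

Lemma branch_nonpos (l : R) : l <= 0 -> exactly_one (Gamma l).
Proof.
move=> l0.
have lm : l < lam m.
  by rewrite (le_lt_trans l0)// amplitude_parameter_gt0.
have [t [/andP[t0 tm] ftl]] := amplitude_parameter_left
  a_gt0 q_gt2 q_lt4 energy_phi_gt0 lm.
exists (w t); split; first by exists t.
move=> _ [s [s0 ls ->]].
have sm : s < m.
  rewrite ltNge; apply/negP => ms; move: l0; rewrite ls leNgt.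
  by rewrite amplitude_parameter_gt0.
rewrite (_ : s = t); first exact: H10_eqxx.
apply: (@amplitude_parameter_inj_left _ a q (energy phi)) => //.
- by rewrite s0 ltW.
- by rewrite t0 ltW.
- by rewrite ftl.
Qed.

Lemma branch_between (l : R) : 0 < l < lam m -> exactly_two (Gamma l).
Proof.
move=> /andP[l0 lm].
have [t [/andP[t0 tm] ftl]] := amplitude_parameter_left
  a_gt0 q_gt2 q_lt4 energy_phi_gt0 lm.
have [u [mu ful]] : exists t, m < t /\ lam t = l.
  by apply: amplitude_parameter_right => //; rewrite l0.
have u0 : 0 < u := lt_trans t0 (lt_trans tm mu).
exists (w t), (w u); split.
- by exists t.
- by exists u.
- by move=> /(H10_scale_inj phi_neq0) E; move: (lt_trans tm mu);
    rewrite E ltxx.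
move=> _ [s [s0 ls ->]]; have [sm|ms] := leP s m; [left|right].
  rewrite (_ : s = t); first exact: H10_eqxx.
  apply: (@amplitude_parameter_inj_left _ a q (energy phi)) => //.
  - by rewrite s0.
  - by rewrite t0 ltW.
  - by rewrite ftl.
rewrite (_ : s = u); first exact: H10_eqxx.
apply: (@amplitude_parameter_inj_right _ a q (energy phi)) => //.
- exact: ltW.
- exact: ltW.
- exact: etrans (esym ls) (esym ful).
Qed.

Lemma branch_turning : exactly_one (Gamma (lam m)) /\ Gamma (lam m) (w m).
Proof.
have m0 := s_star_gt0 a_gt0 q_lt4.
have Gm : Gamma (lam m) (w m) by exists m.
split => //; exists (w m); split => // _ [s [s0 ls ->]].
rewrite (_ : s = m); first exact: H10_eqxx.
apply/eqP/negPn/negP => sm.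
have := amplitude_parameter_lt_max a_gt0 q_gt2 q_lt4 energy_phi_gt0
  s0 sm.
by rewrite -[ltLHS]ls ltxx.
Qed.

Lemma branch_beyond (l : R) : lam m < l -> forall u, ~ Gamma l u.
Proof.
move=> ml _ [s [s0 ls _]]; move: ml; rewrite ls.
have [->|sm] := eqVneq s m; first by rewrite ltxx.
by apply/negP; rewrite -leNgt; apply/ltW/amplitude_parameter_lt_max.
Qed.

End scaling_branch.

Unset Implicit Arguments.

Theorem theorem3p1 (R : realType) (N : nat) (N_gt0 : (0 < N)%N)
    (Om : smooth_domain R N) (a q : R) (a_gt0 : 0 < a) (q_gt2 : 2 < q)
    (q_lt : (q%:E < mine 4%:E (sobolev_exponent R N))%E)
    (k : 'rV[R]_N -> R) (k_cont : {within closure (dom Om), continuous k})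
    (k_gt0 : forall x, closure (dom Om) x -> 0 < k x)
    (phi : H10 Om) (phi_neq0 : H10_neq0 phi)
    (phi_sol : profile_solution k q phi) :
  let lam := lambda_phi a q phi in
  let w := fun s : R => H10_scale s phi in
  let S := [set s : R | 0 < s] in
  let Gamma := on_branch S lam w in
  let turning := nondegenerate_turning_point S lam w in
  ((energy phi)%:E =
     \int[lebesgue_rV N]_(x in dom Om) (k x * `|phi x| `^ q)%:E)%E /\
  (forall s : R, 0 < s -> kirchhoff_solution a k q (lam s) (w s)) /\
  (forall s : R, turning s <-> s = s_star a q) /\
  lam (s_star a q) = lambda_star a q phi /\
  (forall l : R, l <= 0 -> exactly_one (Gamma l)) /\
  (forall l : R, 0 < l < lambda_star a q phi -> exactly_two (Gamma l)) /\
  (exactly_one (Gamma (lambda_star a q phi)) /\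
   Gamma (lambda_star a q phi) (w (s_star a q))) /\
  (forall l : R, lambda_star a q phi < l -> forall u, ~ Gamma l u) /\
  (forall (k' : 'rV[R]_N -> R) (phi' : H10 Om),
     {within closure (dom Om), continuous k'} ->
     (forall x, closure (dom Om) x -> 0 < k' x) ->
     H10_neq0 phi' -> profile_solution k' q phi' ->
     forall s s' : R, turning s ->
       nondegenerate_turning_point S (lambda_phi a q phi')
         (fun t => H10_scale t phi') s' ->
       s' = s).
Proof.
move=> lam w S Gamma turning.
have q_lt4 : q < 4 by move: q_lt; rewrite lt_min lte_fin => /andP[].
have K0 : 0 < energy phi.
  exact: (energy_gt0 k_cont k_gt0 q_gt2).
have lamE : lam (s_star a q) = lambda_star a q phi.
  exact: amplitude_parameter_s_star.
split; first by rewrite energyE phi_sol source_form_diag.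
split; first by move=> s; exact: scaling_branch_solution.
split; first by move=> s; exact: turning_pointP.
split => //; rewrite -lamE.
split; first by move=> l; exact: branch_nonpos.
split; first by move=> l; exact: branch_between.
split; first exact: branch_turning.
split; first by move=> l; exact: branch_beyond.
move=> k' phi' ck' k'0 phi'0 sol' s s' ts ts'.
have K'0 : 0 < energy phi'.
  exact: (energy_gt0 ck' k'0 q_gt2).
rewrite ((turning_pointP a_gt0 q_gt2 q_lt4 phi_neq0 K0 s).1 ts).
exact: (turning_pointP a_gt0 q_gt2 q_lt4 phi'0 K'0 s').1 ts'.
Qed.
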